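(* Let $n,N,l$ be positive integers, let $A_1,\ldots,A_N,B_1,\ldots,B_N\in\mathbb{R}^{n\times n}$ be (entrywise) nonnegative matrices, and let $f:\mathbb{R}^n\to\mathbb{R}^n$ be an admissible diagonal nonlinearity. Suppose there exist numbers $\mu>0$, $\lambda>0$ and vectors $d\gg 0$, $\theta\gg 0$ in $\mathbb{R}^n$ such that $$(A_s+B_r)^T d\le \mu d,\qquad s,r=1,\ldots,N,$$ $$(A_s+B_s)\theta\le\lambda\theta,\qquad s=1,\ldots,N,$$ $$\lambda\mu<1.$$ Then the switched system $$x(k+1)=A_{\sigma(k)}f(x(k))+B_{\sigma(k)}f(x(k-l))$$ is diagonally stable.
   Context: Vector inequalities are componentwise: $v\le w$ means $v_i\le w_i$ for all $i$, and $v\gg 0$ means $v_i>0$ for all $i$. An admissible diagonal nonlinearity is a continuous map $f:\mathbb{R}^n\to\mathbb{R}^n$ of the form $f(x)=(f_1(x_1),\ldots,f_n(x_n))^T$ such that for each $i$: $x_if_i(x_i)>0$ for all $x_i\ne 0$, and $|f_i(x_i)|\le|x_i|$ for all $x_i$. The switching signal $\sigma$ maps the nonnegative integers to $\{1,\ldots,N\}$. The switched system has the associated family of subsystems $x(k+1)=A_sf(x(k))+B_sf(x(k-l))$, $s=1,\ldots,N$. Write $x^{(k)}=(x^T(k),x^T(k-1),\ldots,x^T(k-l))^T\in\mathbb{R}^{(l+1)n}$. The switched system is called diagonally stable if there exist positive definite diagonal matrices $P,Q_1,\ldots,Q_l\in\mathbb{R}^{n\times n}$ such that the functional $$V(x^{(k)})=x^T(k)Px(k)+f^T(x(k-1))Q_1f(x(k-1))+\ldots+f^T(x(k-l))Q_lf(x(k-l))$$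 has negative difference $V(x^{(k+1)})-V(x^{(k)})$ along the trajectories of every subsystem, i.e. for every $s\in\{1,\ldots,N\}$ and every $x^{(k)}\ne 0$, where $x(k+1)$ is given by the $s$-th subsystem. (Such a $V$ is called a common diagonal Lyapunov--Krasovskii functional for the family.) *)

(* Defs.v *)
From mathcomp Require Import all_boot all_order all_algebra.
From mathcomp Require Import all_classical all_reals all_analysis.
Set Implicit Arguments.
Unset Strict Implicit.
Unset Printing Implicit Defensive.
Import Order.TTheory GRing.Theory Num.Theory.
Import numFieldNormedType.Exports.
Local Open Scope ring_scope.

Definition nonneg_mx (R : realType) (m n : nat) (A : 'M[R]_(m, n)) : Prop :=
  forall i j, 0 <= A i j.

Definition vec_le (R : realType) (n : nat) (v w : 'cV[R]_n) : Prop :=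
  forall i, v i ord0 <= w i ord0.

(* v >> 0 *)
Definition vec_pos (R : realType) (n : nat) (v : 'cV[R]_n) : Prop :=
  forall i, 0 < v i ord0.

Definition admissible_diagonal (R : realType) (n : nat)
    (f : 'cV[R]_n -> 'cV[R]_n) : Prop :=
  continuous f /\
  exists phi : 'I_n -> R -> R,
    [/\ forall x i, f x i ord0 = phi i (x i ord0),
        forall i t, t != 0 -> 0 < t * phi i t
      & forall i t, `|phi i t| <= `|t|].

(* x^T M x *)
Definition quad_form (R : realType) (n : nat) (M : 'M[R]_n) (x : 'cV[R]_n) : R :=
  (x^T *m M *m x) ord0 ord0.

Definition pos_def (R : realType) (n : nat) (M : 'M[R]_n) : Prop :=
  M^T = M /\ forall x : 'cV[R]_n, x != 0 -> 0 < quad_form M x.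

(* The extended state x^(k): component j is x(k - j), for j = 0, ..., l. *)
Definition history (R : realType) (n l : nat) : Type :=
  {ffun 'I_l.+1 -> 'cV[R]_n}.

(* The map x^(k) |-> x^(k+1) for the subsystem
   x(k+1) = A f(x(k)) + B f(x(k-l)): component 0 is the new value, and
   component i+1 is the old component i. *)
Definition next_history (R : realType) (n l : nat) (A B : 'M[R]_n)
    (f : 'cV[R]_n -> 'cV[R]_n) (x : history R n l) : history R n l :=
  [ffun j : 'I_l.+1 =>
    if unlift ord0 j is Some i then x (widen_ord (leqnSn l) i)
    else A *m f (x ord0) + B *m f (x ord_max)].

(* The diagonal Lyapunov-Krasovskii functional; the matrix called Q_{j+1}
   in the usual 1-based numbering is Q j, and it weighs
   x (lift ord0 j) = x(k - (j+1)). *)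
Definition LK_functional (R : realType) (n l : nat) (f : 'cV[R]_n -> 'cV[R]_n)
    (P : 'M[R]_n) (Q : 'I_l -> 'M[R]_n) (x : history R n l) : R :=
  quad_form P (x ord0) + \sum_(j < l) quad_form (Q j) (f (x (lift ord0 j))).

(* Diagonal stability, with delay l, of the system
   x(k+1) = A_{sigma(k)} f(x(k)) + B_{sigma(k)} f(x(k-l)).  It is a property
   of the family of subsystems, so the switching signal does not occur. *)
Definition diagonally_stable (R : realType) (n N l : nat)
    (A B : 'I_N -> 'M[R]_n) (f : 'cV[R]_n -> 'cV[R]_n) : Prop :=
  exists (P : 'M[R]_n) (Q : 'I_l -> 'M[R]_n),
    [/\ is_diag_mx P /\ pos_def P,
        forall j, is_diag_mx (Q j) /\ pos_def (Q j)
      & forall (s : 'I_N) (x : history R n l), x != 0 ->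
          LK_functional f P Q (next_history (A s) (B s) f x)
            - LK_functional f P Q x < 0].

(* Main.v *)
Require Import Defs.
From mathcomp Require Import all_boot all_order all_algebra.
From mathcomp Require Import all_classical all_reals all_analysis.
From mathcomp Require Import ring lra.
Set Implicit Arguments.
Unset Strict Implicit.
Unset Printing Implicit Defensive.
Import Order.TTheory GRing.Theory Num.Theory.
Import numFieldNormedType.Exports.
Local Open Scope ring_scope.

(** The matrices come straight from the two positive vectors.  Take
    [P = diag (d_i / theta_i)].  Since the entries of [A_s] and [B_s] are
    nonnegative, Cauchy-Schwarz with the weights [theta] bounds [x+^T P x+],
    where [x+ = A_s u + B_s w], [u = f (x(k))] and [w = f (x(k-l))], by
[[
      lambda * \sum_i ((A_s^T d)_i u_i^2 + (B_s^T d)_i w_i^2) / theta_i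
]]
    (a weighted Schur test, [schur_test]: [theta] controls the row sums and [d]
    the column sums).

    The difference of the sum over the delays has to absorb the term in [w]
    for every [s] at once, so the [Q_j] are built on the componentwise maximum
    [beta] of the vectors [B_r^T d].  This is where the hypothesis on the mixed
    sums [A_s + B_r] enters: it says exactly that [A_s^T d + beta <= mu d] for
    every [s].  With [Q_j = diag (lambda beta_i / theta_i + (l+1-j) eps p_i)],
    [p_i = d_i / theta_i], the sum telescopes ([delay_telescope]), the constant
    part moves [lambda beta] from [w] to [u], and the slope in [j] leaves a term
    [- eps p_i] on every delayed component.  On [u] the total coefficient is
    then at most [(lambda mu + l eps) p_i], which is [(1 - eps) p_i] for
    [eps = (1 - lambda mu) / (l+1)].  As [|u_i| <= |x_i(k)|], the difference of
    the functional is at most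
[[
      - eps * \sum_i p_i (x_i(k)^2 + \sum_j f_i(x_i(k-j))^2)
]]
    and this is negative on nonzero states because [f_i] vanishes only at 0. *)

(** * Diagonal quadratic forms *)

Definition wsq {R : realType} {n : nat} (c : 'I_n -> R) (v : 'cV[R]_n) : R :=
  \sum_i c i * v i ord0 ^+ 2.

Lemma quad_form_diag (R : realType) (n : nat) (c : 'I_n -> R) (v : 'cV[R]_n) :
  quad_form (diag_mx (\row_i c i)) v = wsq c v.
Proof.
rewrite /quad_form -mulmxA mxE; apply: eq_bigr => i _.
by rewrite mul_diag_mx !mxE; ring.
Qed.

Lemma wsq_ge0 (R : realType) (n : nat) (c : 'I_n -> R) (v : 'cV[R]_n) :
  (forall i, 0 <= c i) -> 0 <= wsq c v.
Proof. by move=> c0; apply: sumr_ge0 => i _; rewrite mulr_ge0 ?sqr_ge0. Qed.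

Lemma wsq_gt0 (R : realType) (n : nat) (c : 'I_n -> R) (v : 'cV[R]_n) :
  (forall i, 0 < c i) -> v != 0 -> 0 < wsq c v.
Proof.
move=> c0 v0; rewrite lt_neqAle wsq_ge0 ?andbT => [|i]; last exact: ltW.
apply: contra v0; rewrite eq_sym psumr_eq0 => [/allP v2|i _]; last first.
  by rewrite mulr_ge0 ?sqr_ge0 // ltW.
apply/eqP/colP => i; have /= := v2 i (mem_index_enum i).
by rewrite mxE mulf_eq0 gt_eqF //= sqrf_eq0 => /eqP.
Qed.

Lemma ler_wsq (R : realType) (n : nat) (c c' : 'I_n -> R) (v : 'cV[R]_n) :
  (forall i, c i <= c' i) -> wsq c v <= wsq c' v.
Proof. by move=> cc'; apply: ler_sum => i _; rewrite ler_wpM2r ?sqr_ge0. Qed.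

Lemma ler_wsq_vec (R : realType) (n : nat) (c : 'I_n -> R) (v w : 'cV[R]_n) :
  (forall i, 0 <= c i) -> (forall i, `|v i ord0| <= `|w i ord0|) ->
  wsq c v <= wsq c w.
Proof.
move=> c0 vw; apply: ler_sum => i _; rewrite ler_wpM2l //.
by rewrite -(real_normK (num_real (v i ord0))) -(real_normK (num_real (w i ord0)))
  lerXn2r ?nnegrE.
Qed.

Lemma wsqD (R : realType) (n : nat) (c c' : 'I_n -> R) (v : 'cV[R]_n) :
  wsq (fun i => c i + c' i) v = wsq c v + wsq c' v.
Proof. by rewrite /wsq -big_split; apply: eq_bigr => i _ /=; rewrite mulrDl. Qed.

Lemma wsqZ (R : realType) (n : nat) (a : R) (c : 'I_n -> R) (v : 'cV[R]_n) :
  wsq (fun i => a * c i) v = a * wsq c v.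
Proof. by rewrite /wsq mulr_sumr; apply: eq_bigr => i _; rewrite mulrA. Qed.

Lemma diag_pos_def (R : realType) (n : nat) (c : 'I_n -> R) :
  (forall i, 0 < c i) ->
  is_diag_mx (diag_mx (\row_i c i)) /\ pos_def (diag_mx (\row_i c i)).
Proof.
move=> c0; split; first exact: diag_mx_is_diag.
by split=> [|v v0]; rewrite ?tr_diag_mx // quad_form_diag wsq_gt0.
Qed.

(** * The weighted Schur test *)

(** Cauchy-Schwarz for the weights [a j * t j], with their sum replaced by an
    upper bound [K]: expand [\sum_j a_j t_j (v_j / t_j - T / K)^2 >= 0], where
    [T] is the sum on the left. *)
Lemma sqr_sum_le_weighted (R : realType) (k : nat) (a t v : 'I_k -> R) (K : R) :
  (forall j, 0 <= a j) -> (forall j, 0 < t j) ->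
  \sum_j a j * t j <= K -> 0 < K ->
  (\sum_j a j * v j) ^+ 2 <= K * \sum_j a j * (v j ^+ 2 / t j).
Proof.
move=> a0 t0 SK K0; set T := \sum_j a j * v j; set U := \sum_j _ * (_ / _).
have sq_ge0 : 0 <= \sum_j a j * t j * (v j / t j - T / K) ^+ 2.
  by apply: sumr_ge0 => j _; rewrite mulr_ge0 ?sqr_ge0 // mulr_ge0 // ltW.
have sqE : \sum_j a j * t j * (v j / t j - T / K) ^+ 2
    = U - T / K * 2 * T + (T / K) ^+ 2 * \sum_j a j * t j.
  rewrite /U {3}/T !mulr_sumr -sumrB -big_split /=; apply: eq_bigr => j _.
  by field; rewrite !gt_eqF.
have : (T / K) ^+ 2 * (\sum_j a j * t j) <= (T / K) ^+ 2 * K.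
  by rewrite ler_wpM2l ?sqr_ge0.
have -> : (T / K) ^+ 2 * K = T / K * T by field; rewrite gt_eqF.
move: sq_ge0; rewrite sqE => h1 h2.
have h : T / K * T <= U by lra.
have -> : T ^+ 2 = K * (T / K * T) by field; rewrite gt_eqF.
by rewrite ler_pM2l.
Qed.

Lemma schur_test (R : realType) (m k : nat) (M : 'M[R]_(m, k))
    (d t : 'cV[R]_m) (t' v : 'cV[R]_k) (lambda : R) :
  nonneg_mx M -> vec_pos d -> vec_pos t -> vec_pos t' -> 0 < lambda ->
  vec_le (M *m t') (lambda *: t) ->
  wsq (fun i => d i ord0 / t i ord0) (M *m v)
    <= lambda * wsq (fun j => (M^T *m d) j ord0 / t' j ord0) v.
Proof.
move=> M0 d0 t0 t'0 lam0 Mt.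
have rowP i : d i ord0 / t i ord0 * (M *m v) i ord0 ^+ 2
    <= \sum_j lambda * (d i ord0 * (M i j * (v j ord0 ^+ 2 / t' j ord0))).
  rewrite -mulr_sumr -mulr_sumr.
  set U := \sum_j _.
  have -> : lambda * (d i ord0 * U) = d i ord0 / t i ord0 * (lambda * t i ord0 * U).
    by field; rewrite gt_eqF.
  rewrite ler_pM2l ?divr_gt0 // mxE.
  apply: sqr_sum_le_weighted => [||//|]; rewrite ?mulr_gt0 //.
  by have := Mt i; rewrite !mxE.
apply: (le_trans (ler_sum _ (fun i _ => rowP i))).
rewrite exchange_big /= /wsq mulr_sumr; apply: ler_sum => j _.
rewrite -mulr_sumr ler_pM2l // mxE !mulr_suml; apply: ler_sum => i _.
by rewrite mxE le_eqVlt; apply/orP; left; apply/eqP; ring.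
Qed.

(** The Schur test for the block row [A B] acting on the stacked vector
    [(u, w)], both blocks being weighted by [t]. *)
Lemma schur_test_two (R : realType) (n : nat) (A B : 'M[R]_n)
    (d t u w : 'cV[R]_n) (lambda : R) :
  nonneg_mx A -> nonneg_mx B -> vec_pos d -> vec_pos t -> 0 < lambda ->
  vec_le ((A + B) *m t) (lambda *: t) ->
  wsq (fun i => d i ord0 / t i ord0) (A *m u + B *m w)
    <= lambda * (wsq (fun i => (A^T *m d) i ord0 / t i ord0) u
                 + wsq (fun i => (B^T *m d) i ord0 / t i ord0) w).
Proof.
move=> A0 B0 d0 t0 lam0 ABt.
have := @schur_test _ _ _ (row_mx A B) d t (col_mx t t) (col_mx u w) lambda.
rewrite !mul_row_col -mulmxDl tr_row_mx mul_col_mx.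
have -> : wsq (fun j => col_mx (A^T *m d) (B^T *m d) j ord0
                          / col_mx t t j ord0) (col_mx u w)
  = wsq (fun i => (A^T *m d) i ord0 / t i ord0) u
    + wsq (fun i => (B^T *m d) i ord0 / t i ord0) w.
  rewrite /wsq big_split_ord; congr (_ + _); apply: eq_bigr => i _.
    by rewrite !col_mxEu.
  by rewrite !col_mxEd.
apply=> // [i j|j].
  by rewrite mxE; case: splitP => *; [exact: A0|exact: B0].
by rewrite mxE; case: splitP => *; exact: t0.
Qed.

(** * The Lyapunov-Krasovskii functional *)

(** Shifting the history by one step in a sum over the delays whose weights
    decrease linearly: the [b] part only sees the two ends, and every delayed
    [e] term loses one unit of weight. *)
Lemma delay_telescope (R : realType) (l : nat) (b e : 'I_l.+1 -> R) :
  \sum_(j < l) (b (widen_ord (leqnSn l) j)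
                + (l%:R - j%:R) * e (widen_ord (leqnSn l) j))
  - \sum_(j < l) (b (lift ord0 j) + (l%:R - j%:R) * e (lift ord0 j))
  = b ord0 - b ord_max + l%:R * e ord0 - \sum_(j < l) e (lift ord0 j).
Proof.
pose c (j : 'I_l.+1) := b j + (l%:R - j%:R) * e j.
have shiftE : \sum_(j < l) c (widen_ord (leqnSn l) j) + c ord_max
    = c ord0 + \sum_(j < l) c (lift ord0 j).
  by rewrite -big_ord_recl big_ord_recr.
have -> : \sum_(j < l) (b (lift ord0 j) + (l%:R - j%:R) * e (lift ord0 j))
    = \sum_(j < l) c (lift ord0 j) + \sum_(j < l) e (lift ord0 j).
  rewrite -big_split; apply: eq_bigr => j _.
  by rewrite /c lift0 /= -natr1; ring.
have cmaxE : c ord_max = b ord_max by rewrite /c /= subrr mul0r addr0.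
have c0E : c ord0 = b ord0 + l%:R * e ord0 by rewrite /c /= subr0.
rewrite cmaxE c0E in shiftE.
rewrite opprD addrA; congr (_ - _).
rewrite -[X in X - _ = _]/(\sum_(j < l) c (widen_ord (leqnSn l) j)).
by lra.
Qed.

(** With [Q_j] affine in the delay [j], the difference of the functional involves
    the delayed states other than [x(k)] and [x(k-l)] only through the
    decay terms in [e]. *)
Lemma LK_difference (R : realType) (n l : nat) (A B : 'M[R]_n)
    (f : 'cV[R]_n -> 'cV[R]_n) (p b e : 'I_n -> R) (x : history R n l) :
  let P := diag_mx (\row_i p i) in
  let Q (j : 'I_l) := diag_mx (\row_i (b i + (l%:R - j%:R) * e i)) in
  LK_functional f P Q (next_history A B f x) - LK_functional f P Q x
  = wsq p (A *m f (x ord0) + B *m f (x ord_max)) - wsq p (x ord0)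
    + (wsq b (f (x ord0)) - wsq b (f (x ord_max))
       + l%:R * wsq e (f (x ord0)) - \sum_(j < l) wsq e (f (x (lift ord0 j)))).
Proof.
move=> P Q; rewrite /LK_functional !quad_form_diag ffunE unlift_none.
rewrite -(@delay_telescope _ _ (fun j => wsq b (f (x j))) (fun j => wsq e (f (x j)))).
rewrite -addrA opprD addrACA addrA; congr (_ + _ + (_ - _)).
  by apply: eq_bigr => j _; rewrite ffunE liftK quad_form_diag wsqD wsqZ.
by apply: eq_bigr => j _; rewrite quad_form_diag wsqD wsqZ.
Qed.

Lemma history_neq0 (R : realType) (n l : nat) (x : history R n l) :
  x != 0 -> exists j, x j != 0.
Proof.
move=> x0; apply/existsP; apply: contraR x0; rewrite negb_exists => /forallP x0.
by apply/eqP/ffunP => j; rewrite ffunE; apply/eqP; rewrite -[_ == _]negbK.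
Qed.

Lemma admissible_neq0 (R : realType) (n : nat) (f : 'cV[R]_n -> 'cV[R]_n) v :
  admissible_diagonal f -> v != 0 -> f v != 0.
Proof.
move=> [_ [phi [fE phi_gt0 _]]]; apply: contra => /eqP fv0.
apply/eqP/colP => i; rewrite [RHS]mxE; apply/eqP; apply: contraT => /(phi_gt0 i).
by rewrite -fE fv0 mxE mulr0 ltxx.
Qed.

Lemma admissible_le (R : realType) (n : nat) (f : 'cV[R]_n -> 'cV[R]_n) v i :
  admissible_diagonal f -> `|f v i ord0| <= `|v i ord0|.
Proof. by move=> [_ [phi [fE _ phi_le]]]; rewrite fE. Qed.

Lemma mulmx_tr_ge0 (R : realType) (n : nat) (B : 'M[R]_n) (d : 'cV[R]_n) i :
  nonneg_mx B -> vec_pos d -> 0 <= (B^T *m d) i ord0.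
Proof.
by move=> B0 d0; rewrite mxE sumr_ge0 // => j _; rewrite mxE mulr_ge0 // ltW.
Qed.

Theorem theorem4p1 (R : realType) (n N l : nat)
    (n_gt0 : (0 < n)%N) (N_gt0 : (0 < N)%N) (l_gt0 : (0 < l)%N)
    (A B : 'I_N -> 'M[R]_n) (f : 'cV[R]_n -> 'cV[R]_n)
    (A_ge0 : forall s, nonneg_mx (A s)) (B_ge0 : forall s, nonneg_mx (B s))
    (f_adm : admissible_diagonal f)
    (hyp : exists (mu lambda : R) (d theta : 'cV[R]_n),
       (0 < mu /\ 0 < lambda) /\ (vec_pos d /\ vec_pos theta) /\
       [/\ forall s r : 'I_N, vec_le ((A s + B r)^T *m d) (mu *: d),
           forall s : 'I_N, vec_le ((A s + B s) *m theta) (lambda *: theta)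
         & lambda * mu < 1]) :
  diagonally_stable l A B f.
Proof.
have [mu [lambda [d [t [[mu0 lam0] [[d0 t0] [Hd Ht lm1]]]]]]] := hyp.
pose beta i := \big[Num.max/0]_(r < N) ((B r)^T *m d) i ord0.
have beta_ge0 i : 0 <= beta i by rewrite /beta; exact: bigmax_ge_id.
have beta_ub r i : ((B r)^T *m d) i ord0 <= beta i.
  by rewrite /beta; exact: (le_bigmax _ (fun r : 'I_N => ((B r)^T *m d) i ord0)).
have A_beta s i : ((A s)^T *m d) i ord0 + beta i <= mu * d i ord0.
  have AB r : ((A s)^T *m d) i ord0 + ((B r)^T *m d) i ord0 <= mu * d i ord0.
    by have := Hd s r i; rewrite linearD /= mulmxDl mxE [leRHS]mxE.
  (* The default value 0 of the maximum leaves [A_s^T d <= mu d], which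
     follows from the case [r = s] because [B_s >= 0]. *)
  rewrite -lerBrDl; apply: bigmax_le => [|r _]; last by rewrite lerBrDl.
  rewrite subr_ge0; apply: le_trans (AB s); rewrite lerDl.
  exact: mulmx_tr_ge0.
(* The decay rate solves [lambda mu + l eps = 1 - eps]: the slope of the
   [Q_j] costs [l eps] on [f (x(k))], and [eps] is left over on [x(k)]. *)
pose eps : R := (1 - lambda * mu) / l.+1%:R.
have eps_gt0 : 0 < eps by rewrite divr_gt0 ?subr_gt0.
have epsE : lambda * mu + l%:R * eps = 1 - eps.
  have : eps * l.+1%:R = 1 - lambda * mu by rewrite mulfVK ?pnatr_eq0.
  by rewrite -natr1 => h; lra.
pose p i := d i ord0 / t i ord0.
pose b i := lambda * (beta i / t i ord0).
pose e i := eps * p i.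
have p_gt0 i : 0 < p i by rewrite divr_gt0.
have b_ge0 i : 0 <= b i by rewrite mulr_ge0 ?divr_ge0 // ltW.
have e_gt0 i : 0 < e i by rewrite mulr_gt0.
exists (diag_mx (\row_i p i)),
  (fun j : 'I_l => diag_mx (\row_i (b i + (l%:R - j%:R) * e i))).
split=> [|j|s x x_neq0].
- exact: diag_pos_def.
- apply: diag_pos_def => i; apply: ltr_wpDl => //.
  by rewrite mulr_gt0 // subr_gt0 ltr_nat.
rewrite LK_difference.
set x0 := x ord0; set u := f x0; set w := f (x ord_max).
pose a i := ((A s)^T *m d) i ord0 / t i ord0.
have step := @schur_test_two _ _ _ _ d t u w _ (A_ge0 s) (B_ge0 s) d0 t0 lam0 (Ht s).
rewrite mulrDr -!wsqZ in step.
have w_le : wsq (fun i => lambda * (((B s)^T *m d) i ord0 / t i ord0)) w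
    <= wsq b w.
  by apply: ler_wsq => i; rewrite ler_pM2l // ler_pM2r ?invr_gt0.
(* The total coefficient of [u_i^2] in the bound on the difference. *)
pose c i := lambda * a i + b i + l%:R * e i.
have c_le i : c i + e i <= p i.
  have : lambda * (a i + beta i / t i ord0) <= lambda * (mu * p i).
    by rewrite ler_pM2l // /a /p -mulrDl mulrA ler_pM2r ?invr_gt0.
  have := congr1 ( *%R^~ (p i)) epsE; rewrite /= /c /b /e => h1 h2.
  by lra.
have c_ge0 i : 0 <= c i.
  have a_ge0 : 0 <= a i by rewrite divr_ge0 ?mulmx_tr_ge0 // ltW.
  by rewrite /c !addr_ge0 // mulr_ge0 // ltW.
have u_le : wsq c u + wsq e x0 <= wsq p x0.
  apply: le_trans (ler_wsq _ c_le); rewrite (wsqD c e) lerD2r.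
  by apply: ler_wsq_vec => // i; exact: admissible_le.
have cE : wsq c u
    = wsq (fun i => lambda * a i) u + wsq b u + l%:R * wsq e u.
  by rewrite -(wsqZ l%:R e) -!wsqD.
have decay_gt0 : 0 < wsq e x0 + \sum_(j < l) wsq e (f (x (lift ord0 j))).
  have e_ge0 v : 0 <= wsq e v by apply: wsq_ge0 => i; exact: ltW.
  have sum_ge0 : 0 <= \sum_(j < l) wsq e (f (x (lift ord0 j))).
    by apply: sumr_ge0.
  (* [x(k)] itself enters without [f]; on a delayed component [f] has to be
     nonzero too. *)
  have [j] := history_neq0 x_neq0.
  case: (unliftP ord0 j) => [i ->|->] xj; last by rewrite ltr_wpDr // wsq_gt0.
  rewrite ltr_wpDl // (bigD1 i) //= ltr_wpDr ?sumr_ge0 //.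
  by rewrite wsq_gt0 ?admissible_neq0.
rewrite cE in u_le.
by rewrite -/p -/a in step; lra.
Qed.
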